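(* Let $S$ be a closed, densely defined, symmetric operator in a separable Hilbert space $\mathcal H$, let $\{\mathcal G,\Gamma_0,\Gamma_1\}$ be a quasi boundary triple for $\overline T=S^*$ with corresponding Weyl function $M$, and let $A_0=T\upharpoonright\ker\Gamma_0$. Then $\lambda\in\mathbb R$ is an eigenvalue of $A_0$ such that $\mathcal K:=\ker(A_0-\lambda)\ominus\ker(S-\lambda)\ne\{0\}$ if and only if $R_\lambda M:=\text{s-}\lim_{\eta\searrow0}i\eta M(\lambda+i\eta)\ne0$. If $\dim\mathcal K<\infty$, then the mapping $$\tau:\mathcal K\to\operatorname{ran}R_\lambda M,\quad u\mapsto\Gamma_1u,$$ is bijective; if $\dim\mathcal K=\infty$, then the mapping $$\tau:\mathcal K\to\operatorname{cl}_\tau(\operatorname{ran}R_\lambda M),\quad u\mapsto\Gamma_1u,$$ is bijective, where $\operatorname{cl}_\tau$ denotes the closure in the normed space $\operatorname{ran}\tau=\Gamma_1(\mathcal K)$ (with the norm of $\mathcal G$).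
   Context: Quasi boundary triple: let $S$ be a closed, densely defined, symmetric operator in a separable Hilbert space $\mathcal H$ and let $T\subset S^*$ be an operator with $\overline T=S^*$. A triple $\{\mathcal G,\Gamma_0,\Gamma_1\}$ consisting of a Hilbert space $\mathcal G$ and two linear mappings $\Gamma_0,\Gamma_1:\operatorname{dom}T\to\mathcal G$ is a quasi boundary triple for $S^*$ if (1) the range of $(\Gamma_0,\Gamma_1)^\top:\operatorname{dom}T\to\mathcal G\times\mathcal G$ is dense; (2) $(Tu,v)_{\mathcal H}-(u,Tv)_{\mathcal H}=(\Gamma_1u,\Gamma_0v)_{\mathcal G}-(\Gamma_0u,\Gamma_1v)_{\mathcal G}$ for all $u,v\in\operatorname{dom}T$; (3) $A_0:=T\upharpoonright\ker\Gamma_0$ is selfadjoint in $\mathcal H$. For $\lambda\in\rho(A_0)$ one has $\operatorname{dom}T=\ker\Gamma_0\dotplus\ker(T-\lambda)$; the $\gamma$-field and Weyl function are $\gamma(\lambda)=(\Gamma_0\upharpoonright\ker(T-\lambda))^{-1}$ and $M(\lambda)=\Gamma_1\gamma(\lambda)$, both defined on the dense subspace $\operatorname{ran}\Gamma_0$ of $\mathcal G$. The limit $(R_\lambda M)g=\lim_{\eta\searrow0}i\eta M(\lambda+i\eta)g$ exists for all $\lambda\in\mathbb R$ and $g\in\operatorname{ran}\Gamma_0$; s-$\lim$ is the strong limit on $\operatorname{ran}\Gamma_0$. *)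

(* Defs.v *)
From HB Require Import structures.
From mathcomp Require Import all_boot all_order all_algebra.
From mathcomp Require Import all_classical all_reals all_analysis.
From mathcomp Require Export sesquilinear complex.

Set Implicit Arguments.
Unset Strict Implicit.
Unset Printing Implicit Defensive.

Import Order.TTheory GRing.Theory Num.Theory Num.Def.
Import numFieldNormedType.Exports.

Local Open Scope classical_set_scope.
Local Open Scope ring_scope.
Local Open Scope complex_scope.

(* A Hilbert space is a complete normed space over R[i] together with an inner
   product (linear in the first, conjugate-linear in the second argument) that
   induces its norm. *)
Definition norm_induced_by (R : realType) (H : completeNormedModType R[i])
    (ip : {dot H for conjC}) : Prop :=
  forall x : H, ip x x = `|x| ^+ 2.

Definition separable (T : topologicalType) : Prop :=
  exists2 D : set T, countable D & dense D.

(* The values of [op_fun] outside [dom] are irrelevant. *)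
Record operator (U V : Type) := Operator { dom : set U; op_fun :> U -> V }.

Section LinearOperators.
Context (K : numFieldType) (U V : lmodType K).

Definition linear_on (D : set U) (f : U -> V) : Prop :=
  forall (a : K) (u v : U), D u -> D v -> f (a *: u + v) = a *: f u + f v.

Definition is_subspace (D : set U) : Prop :=
  D 0 /\ forall (a : K) (u v : U), D u -> D v -> D (a *: u + v).

Definition linear_operator (A : operator U V) : Prop :=
  is_subspace (dom A) /\ linear_on (dom A) A.

Definition graph (A : operator U V) : set (U * V) :=
  [set (u, A u) | u in dom A].

Definition op_range (A : operator U V) : set V := A @` dom A.

Definition op_nonzero (A : operator U V) : Prop :=
  exists2 u, dom A u & A u != 0.

Definition finite_dim (E : set U) : Prop :=
  exists (n : nat) (e : 'I_n -> U),
    E = [set \sum_(i < n) c i *: e i | c in [set: 'I_n -> K]].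

(* ker (A - z) *)
Definition op_eigenspace (A : operator U U) (z : K) : set U :=
  [set u | dom A u /\ A u = z *: u].

Definition op_eigenvalue (A : operator U U) (z : K) : Prop :=
  exists2 u, op_eigenspace A z u & u != 0.

End LinearOperators.

(* For A `<=` B this is the closure of A in the space B. *)
Definition relative_closure (T : topologicalType) (B A : set T) : set T :=
  B `&` closure A.

Section HilbertOperators.
Context (R : realType) (H : completeNormedModType R[i]).
Variable ip : {dot H for conjC}.

Definition ortho_compl (E : set H) : set H :=
  [set u | forall v, E v -> ip u v = 0].

(* E (-) F *)
Definition ominus (E F : set H) : set H := E `&` ortho_compl F.

Definition densely_defined (A : operator H H) : Prop := dense (dom A).

Definition closed_operator (A : operator H H) : Prop := closed (graph A).

(* The graph of A^*: v is in dom A^* with A^* v = w iff (A u, v) = (u, w) for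
   all u in dom A.  It is single-valued when A is densely defined. *)
Definition adjoint_graph (A : operator H H) : set (H * H) :=
  [set p | forall u, dom A u -> ip (A u) p.1 = ip u p.2].

Definition symmetric_operator (A : operator H H) : Prop :=
  forall u v, dom A u -> dom A v -> ip (A u) v = ip u (A v).

Definition selfadjoint_operator (A : operator H H) : Prop :=
  densely_defined A /\ graph A = adjoint_graph A.

End HilbertOperators.

Section BoundaryTriples.
Context (R : realType) (H G : completeNormedModType R[i]).
Variables (ipH : {dot H for conjC}) (ipG : {dot G for conjC}).

Section Fields.
Variables (T : operator H H) (Gamma0 Gamma1 : H -> G).

Definition A0_of : operator H H :=
  Operator (dom T `&` Gamma0 @^-1` [set 0]) T.

(* The inverse of Gamma0 restricted to ker (T - z).  The choice made by [pinv] is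
   forced when z is in the resolvent set of A0, in particular for nonreal z:
   there dom T is the direct sum of ker Gamma0 and ker (T - z), so that Gamma0
   maps ker (T - z) bijectively onto ran Gamma0. *)
Definition gamma_field (z : R[i]) : operator G H :=
  Operator (Gamma0 @` dom T)
    ('pinv_(fun=> 0) (op_eigenspace T z) Gamma0).

Definition weyl (z : R[i]) : operator G G :=
  Operator (Gamma0 @` dom T) (Gamma1 \o gamma_field z).

(* Strong limit on ran Gamma0, that is, pointwise in g; it exists at every real
   lambda and every g in ran Gamma0, so the default value of [lim] plays no
   role. *)
Definition weyl_residue (lambda : R) : operator G G :=
  Operator (Gamma0 @` dom T) (fun g =>
    lim (('i * eta%:C) *: weyl (lambda%:C + 'i * eta%:C) g
           @[eta --> (0 : R)^'+])).

End Fields.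

Record quasi_boundary_triple (S T : operator H H) (Gamma0 Gamma1 : H -> G) :
    Prop := QuasiBoundaryTriple {
  qbt_linear_T : linear_operator T ;
  qbt_sub_adjoint : graph T `<=` adjoint_graph ipH S ;
  qbt_closure : closure (graph T) = adjoint_graph ipH S ;
  qbt_linear_Gamma0 : linear_on (dom T) Gamma0 ;
  qbt_linear_Gamma1 : linear_on (dom T) Gamma1 ;
  qbt_dense_range : dense [set (Gamma0 u, Gamma1 u) | u in dom T] ;
  qbt_green : forall u v, dom T u -> dom T v ->
    ipH (T u) v - ipH u (T v) =
    ipG (Gamma1 u) (Gamma0 v) - ipG (Gamma0 u) (Gamma1 v) ;
  qbt_selfadjoint : selfadjoint_operator ipH (A0_of T Gamma0)
}.

End BoundaryTriples.

(* Main.v *)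
(* For w in dom T write (T - lambda) w = f + p with f in the closure of
   ran (A0 - lambda) and p in ker (A0 - lambda).  The gamma-field at
   z = lambda + i eta maps Gamma0 w to w - r, where r = (A0 - z)^-1 (T - z) w, and
   a mean ergodic argument shows i eta r -> - p, even in the graph norm of A0.
   By Banach-Steinhaus Gamma1 is bounded on dom A0 for that norm, so
   R_lambda M (Gamma0 w) = Gamma1 p.

   Since ker (S - lambda) is the kernel of Gamma1 on ker (A0 - lambda), p may be
   replaced by its component k in K, and Gamma1 is injective on K.  By Green's
   identity ((T - lambda) w, v) = - (Gamma0 w, Gamma1 v) for v in K, so the vectors
   k form a subspace D of K whose orthogonal complement in K is {0}: D is dense in
   K, and equal to K when dim K < oo. *)
Require Import Defs.
From mathcomp Require Import all_boot all_order all_algebra.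
From mathcomp Require Import all_classical all_reals all_analysis.
From mathcomp Require Import ring lra.
Import GRing.Theory Num.Theory Num.Def numFieldNormedType.Exports.
Import Order.TTheory.
Local Open Scope classical_set_scope.
Local Open Scope ring_scope.
Local Open Scope complex_scope.

Set Implicit Arguments.
Unset Strict Implicit.

(** * Real-valued norms and sequential topology *)

Section RealNorm.
Context {R : realType}.

(** Norms of a normed space over [R[i]] are themselves elements of [R[i]]. Taking the real part
    moves estimates into the ordered field [R], where [lra], [nra] and infima apply. *)
Definition nr {V : normedZmodType R[i]} (x : V) : R := complex.Re `|x|.

Section Zmod.
Context {V : normedZmodType R[i]}.
Implicit Types x y : V.

Lemma nrE x : `|x| = (nr x)%:C.
Proof. by rewrite /nr RRe_real // normr_real. Qed.

Lemma nr_ge0 x : 0 <= nr x.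
Proof. by rewrite -ler0c -nrE normr_ge0. Qed.

Lemma nrD x y : nr (x + y) <= nr x + nr y.
Proof. by rewrite -lecR rmorphD /= -!nrE ler_normD. Qed.

Lemma nrN x : nr (- x) = nr x.
Proof. by rewrite /nr normrN. Qed.

Lemma nrBC x y : nr (x - y) = nr (y - x).
Proof. by rewrite /nr distrC. Qed.

Lemma nrB x y : nr (x - y) <= nr x + nr y.
Proof. by rewrite (le_trans (nrD _ _)) // nrN. Qed.

Lemma nr0 : nr (0 : V) = 0.
Proof. by rewrite /nr normr0. Qed.

Lemma nr_eq0 x : (nr x == 0) = (x == 0).
Proof. by rewrite -(inj_eq (@complexI R)) -nrE normr_eq0. Qed.

Lemma nr_gt0 x : (0 < nr x) = (x != 0).
Proof. by rewrite lt_def nr_ge0 andbT nr_eq0. Qed.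

Lemma nr_le0 x : nr x <= 0 -> x = 0.
Proof. by move=> h; apply/eqP; rewrite -nr_eq0 eq_le h nr_ge0. Qed.

Lemma nr_lt (e : R) x : (`|x| < e%:C) = (nr x < e).
Proof. by rewrite nrE ltcR. Qed.

End Zmod.

Lemma nrZ (V : normedModType R[i]) (a : R[i]) (x : V) : nr (a *: x) = nr a * nr x.
Proof. by apply: (@complexI R); rewrite rmorphM /= -!nrE normrZ. Qed.

Lemma nrM (a b : R[i]) : nr (a * b) = nr a * nr b.
Proof. by apply: (@complexI R); rewrite rmorphM /= -!nrE normrM. Qed.

Lemma nrV (a : R[i]) : nr a^-1 = (nr a)^-1.
Proof. by apply: (@complexI R); rewrite fmorphV /= -!nrE normfV. Qed.

Lemma nr_real (a : R) : nr (a%:C : R[i]) = `|a|.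
Proof.
by rewrite /nr normc_def /= expr0n addr0 sqrtr_sqr.
Qed.

Lemma nr_nat (n : nat) : nr (n%:R : R[i]) = n%:R.
Proof. by rewrite -(rmorph_nat (real_complex R)) nr_real ger0_norm ?ler0n. Qed.

Lemma nr_i : nr ('i%R : R[i]) = 1.
Proof. by rewrite /nr normCi. Qed.

Lemma gt0_complex (e : R[i]) : 0 < e -> exists2 d : R, 0 < d & e = d%:C.
Proof.
by move=> e0; exists (complex.Re e); rewrite -?ltcR RRe_real // gtr0_real.
Qed.

Lemma conjC_realC (a : R) : conjC (a%:C : R[i]) = a%:C.
Proof. by apply/CrealP; apply/complex_realP; exists a. Qed.

End RealNorm.

Section Topology.
Context {R : realType} {V : normedModType R[i]}.

Lemma cvg_nr (T : Type) (F : set_system T) (FF : Filter F) (f : T -> V) (l : V) :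
  (forall e : R, 0 < e -> \forall t \near F, nr (l - f t) < e) -> f t @[t --> F] --> l.
Proof.
move=> h; apply/cvgrPdist_lt => e /gt0_complex[d d0 ->].
by apply: filterS (h d d0) => t; rewrite nr_lt.
Qed.

Lemma closure_nr (A : set V) (x : V) :
  closure A x <-> forall e : R, 0 < e -> exists2 a, A a & nr (x - a) < e.
Proof.
split=> [clA e e0|h B /nbhs_normP[e /= /gt0_complex[d d0 ->] sB]].
  have [|a [Aa xa]] := clA (ball_ normr x e%:C).
    by apply/nbhs_normP; exists e%:C => //=; rewrite ltcR.
  by exists a => //; rewrite -nr_lt.
by have [a Aa xa] := h d d0; exists a; split=> //; apply: sB; rewrite /= nr_lt.
Qed.

Lemma closed_nr (A : set V) (x : V) : closed A ->
  (forall e : R, 0 < e -> exists2 a, A a & nr (x - a) < e) -> A x.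
Proof. by move=> cA h; apply: cA; apply/closure_nr. Qed.

Lemma closure_is_subspace (A : set V) : is_subspace A -> is_subspace (closure A).
Proof.
move=> [A0 AD]; split=> [|a u v /closure_nr hu /closure_nr hv].
  exact: subset_closure.
apply/closure_nr => e e0.
have a0 := nr_ge0 a.
have [|u' Au' uu'] := hu (e / 2 / (nr a + 1)).
  by rewrite !divr_gt0 //; lra.
have [|v' Av' vv'] := hv (e / 2); first lra.
exists (a *: u' + v'); first exact: AD.
have -> : a *: u + v - (a *: u' + v') = a *: (u - u') + (v - v').
  by rewrite scalerBr opprD addrACA.
rewrite (le_lt_trans (nrD _ _)) // nrZ.
move: uu'; rewrite ltr_pdivlMr; last lra.
have := nr_ge0 (u - u'); nra.
Qed.

End Topology.

Lemma inv_succ_small (R : realType) (e : R) : 0 < e ->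
  exists N, forall n, (N <= n)%N -> (n.+1%:R : R)^-1 < e.
Proof.
move=> e0; exists (truncn e^-1) => n Nn.
rewrite -[X in _ < X]invrK ltf_pV2 ?posrE ?invr_gt0 ?ltr0n //.
by rewrite (lt_le_trans (truncnS_gt _)) // ler_nat ltnS.
Qed.

Lemma closure_seq (R : realType) (V : normedModType R[i]) (A : set V) (x : V) :
  closure A x -> exists2 s : nat -> V, forall n, A (s n) &
    forall e : R, 0 < e -> exists N, forall n, (N <= n)%N -> nr (x - s n) < e.
Proof.
move/closure_nr => h.
have /choice[s hs] : forall n : nat, exists a, A a /\ nr (x - a) < (n.+1%:R : R)^-1.
  by move=> n; have [|a Aa ?] := h n.+1%:R^-1; [rewrite invr_gt0 ltr0n|exists a].
exists s => [n|e /inv_succ_small[N hN]]; first by case: (hs n).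
by exists N => n /hN; apply: lt_trans; case: (hs n).
Qed.

Lemma closed_seq (R : realType) (V : normedModType R[i]) (A : set V) :
  (forall (x : V) (s : nat -> V), (forall n, A (s n)) ->
     (forall e : R, 0 < e -> exists N, forall n, (N <= n)%N -> nr (x - s n) < e) -> A x) ->
  closed A.
Proof. by move=> h x /closure_seq[s hs sx]; exact: h hs sx. Qed.

Section ProductTopology.
Context {R : realType} {V W : normedModType R[i]}.

Lemma closure_prod_nr (A : set (V * W)) (x : V) (y : W) :
  closure A (x, y) <->
  forall e : R, 0 < e -> exists2 a, A a & nr (x - a.1) < e /\ nr (y - a.2) < e.
Proof.
have E (a : V * W) (e : R) :
    nr ((x, y) - a) < e <-> nr (x - a.1) < e /\ nr (y - a.2) < e.
  rewrite -!nr_lt prod_normE /=; split=> [h|[h1 h2]].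
    by split; apply: le_lt_trans h; rewrite ?num_le_max ?lexx ?orbT.
  rewrite !nrE in h1 h2 *; rewrite !ltcR in h1 h2.
  by rewrite /maxr; case: ifP => _; rewrite ltcR.
by split=> [/closure_nr h e /h[a Aa /E ?]|h]; [|apply/closure_nr => e /h[a Aa /E ?]];
  exists a.
Qed.

End ProductTopology.

Section Completeness.
Context {R : realType} {H : completeNormedModType R[i]}.

Lemma cauchy_nr (x : nat -> H) :
  (forall e : R, 0 < e -> exists N, forall m n, (N <= m)%N -> (N <= n)%N -> nr (x m - x n) < e) ->
  exists l, forall e : R, 0 < e -> exists N, forall n, (N <= n)%N -> nr (l - x n) < e.
Proof.
move=> h.
have /cauchy_cvgP/cvg_ex[l xl] : cauchy (x n @[n --> \oo]).
  apply/cauchy_ballP => _ /gt0_complex[e e0 ->].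
  have [N hN] := h e e0.
  exists (x @` [set n | (N <= n)%N], x @` [set n | (N <= n)%N]) => /=.
    by split; exists N => //= n Nn; exists n.
  by move=> [_ _] /= [[m hm <-] [n hn <-]]; rewrite -ball_normE /= nr_lt hN.
exists l => e e0.
have /cvgrPdist_lt/(_ e%:C) := xl.
rewrite ltcR => /(_ e0) [N _ hN].
by exists N => n /hN /=; rewrite nr_lt.
Qed.

End Completeness.

(** * Inner products and orthogonal projections *)

Section LinearOn.
Context {K : numFieldType} {U V : lmodType K} {D : set U} {f : U -> V}.

Lemma subspaceD : is_subspace D -> forall u v, D u -> D v -> D (u + v).
Proof. by move=> [_ h] u v Du Dv; rewrite -[u]scale1r; exact: h. Qed.

Lemma subspaceZ : is_subspace D -> forall a u, D u -> D (a *: u).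
Proof. by move=> [h0 h] a u Du; rewrite -[a *: u]addr0; exact: h. Qed.

Lemma subspaceB : is_subspace D -> forall u v, D u -> D v -> D (u - v).
Proof.
by move=> sD u v Du Dv; apply: subspaceD => //; rewrite -scaleN1r; exact: subspaceZ.
Qed.

Hypotheses (sD : is_subspace D) (lf : linear_on D f).

Lemma linear_onD u v : D u -> D v -> f (u + v) = f u + f v.
Proof. by move=> Du Dv; rewrite -[u in LHS]scale1r lf // scale1r. Qed.

Lemma linear_on0 : f 0 = 0.
Proof.
have := linear_onD (proj1 sD) (proj1 sD).
by rewrite addr0 => /eqP; rewrite -subr_eq subrr eq_sym => /eqP.
Qed.

Lemma linear_onZ a u : D u -> f (a *: u) = a *: f u.
Proof. by move=> Du; rewrite -[a *: u]addr0 lf ?linear_on0 ?addr0 //; case: sD. Qed.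

Lemma linear_onB u v : D u -> D v -> f (u - v) = f u - f v.
Proof.
move=> Du Dv; rewrite -scaleN1r addrC lf // scaleN1r addrC //.
Qed.

Lemma linear_on_image : is_subspace (f @` D).
Proof.
split=> [|a _ _ [u Du <-] [v Dv <-]]; first by exists 0; rewrite ?linear_on0 //; case: sD.
by exists (a *: u + v); rewrite ?lf //; apply: (proj2 sD).
Qed.

End LinearOn.

Lemma linear_on_shift (K : numFieldType) (U : lmodType K) (D : set U) (f : U -> U) (z : K) :
  linear_on D f -> linear_on D (fun u => f u - z *: u).
Proof.
move=> lf a u v Du Dv; rewrite lf // scalerDr opprD scalerA mulrC -scalerA addrACA.
by rewrite scalerBr.
Qed.

Section InnerProduct.
Context {R : realType} {H : completeNormedModType R[i]} {ip : {dot H for conjC}}.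
Hypothesis hilb : norm_induced_by ip.
Implicit Types (u v w : H) (a : R[i]).

Lemma ipC u v : ip u v = conjC (ip v u).
Proof. by rewrite (hermC ip) expr0 mul1r. Qed.

Lemma ipDl u v w : ip (u + v) w = ip u w + ip v w. Proof. exact: linearDl. Qed.
Lemma ipNl u w : ip (- u) w = - ip u w. Proof. exact: linearNl. Qed.
Lemma ipZl a u w : ip (a *: u) w = a * ip u w. Proof. exact: linearZl_LR. Qed.
Lemma ip0l w : ip 0 w = 0. Proof. exact: linear0l. Qed.
Lemma ipDr u v w : ip w (u + v) = ip w u + ip w v.
Proof. by rewrite ipC ipDl rmorphD /= -!ipC. Qed.
Lemma ipNr u w : ip w (- u) = - ip w u.
Proof. by rewrite ipC ipNl rmorphN /= -!ipC. Qed.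
Lemma ipZr a u w : ip w (a *: u) = conjC a * ip w u.
Proof. by rewrite ipC ipZl rmorphM /= -ipC. Qed.
Lemma ip0r w : ip w 0 = 0.
Proof. by rewrite ipC ip0l rmorph0. Qed.

Definition ipE := (ipDl, ipNl, ipZl, ip0l, ipDr, ipNr, ipZr, ip0r).

Lemma ip_nr u : ip u u = (nr u ^+ 2)%:C.
Proof. by rewrite hilb nrE -rmorphXn. Qed.

Lemma ip_eq0 u : ip u u = 0 -> u = 0.
Proof. by move/eqP; rewrite dnorm_eq0 => /eqP. Qed.

Lemma ip_sym0 u v : ip u v = 0 -> ip v u = 0.
Proof. by move=> h; rewrite ipC h rmorph0. Qed.

Lemma ip_ext u v : (forall w, ip u w = ip v w) -> u = v.
Proof.
by move=> h; apply/eqP; rewrite -subr_eq0; apply/eqP/ip_eq0; rewrite ipDl ipNl h subrr.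
Qed.

Lemma pythagoras u v : ip u v = 0 -> nr (u + v) ^+ 2 = nr u ^+ 2 + nr v ^+ 2.
Proof.
move=> uv; apply: (@complexI R); rewrite rmorphD /= -!ip_nr !ipE uv (ip_sym0 uv).
by rewrite addr0 add0r.
Qed.

Lemma parallelogram u v :
  nr (u + v) ^+ 2 + nr (u - v) ^+ 2 = 2 * nr u ^+ 2 + 2 * nr v ^+ 2.
Proof.
have : ip (u + v) (u + v) + ip (u - v) (u - v) = ip u u + ip u u + (ip v v + ip v v).
  by rewrite !ipE; ring.
by rewrite !ip_nr -!rmorphD => /complexI; lra.
Qed.

(** With [a *: v] the projection of [u] on the line of [v], Pythagoras gives |a v| <= |u|, and |a v|
    equals |(u, v)| / |v|. *)
Lemma cauchy_schwarz u v : nr (ip u v) <= nr u * nr v.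
Proof.
have [->|v0] := eqVneq v 0; first by rewrite ip0r !nr0 mulr0.
have nv : 0 < nr v by rewrite nr_gt0.
pose a := ip u v / ip v v.
have iv : ip v v != 0 by rewrite dnorm_eq0.
have o : ip (u - a *: v) (a *: v) = 0.
  by rewrite ipZr ipDl ipNl ipZl /a divfK // subrr mulr0.
have := pythagoras o; rewrite subrK => e.
have le : nr (a *: v) <= nr u.
  by rewrite -(@ler_pXn2r _ 2) ?nnegrE ?nr_ge0 // e lerDr sqr_ge0.
move: le; rewrite nrZ /a nrM nrV ip_nr nr_real ger0_norm ?sqr_ge0 //.
rewrite -mulrA expr2 invfM -mulrA mulVf ?mulr1; last by rewrite gt_eqF.
by rewrite ler_pdivrMr // mulrC.
Qed.

Lemma nr_ip_eq0 (z : R[i]) : (forall e : R, 0 < e -> nr z <= e) -> z = 0.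
Proof.
move=> h; apply: nr_le0; rewrite leNgt; apply/negP => z0.
by have := h (nr z / 2); rewrite divr_gt0 // => /(_ isT); lra.
Qed.

Lemma ortho_compl_closed (E : set H) : closed (ortho_compl ip E).
Proof.
move=> u /closure_nr h v Ev; apply: nr_ip_eq0 => e e0.
have v0 := nr_ge0 v.
have [|u' u'E uu'] := h (e / (nr v + 1)); first by rewrite divr_gt0 //; lra.
have -> : ip u v = ip (u - u') v by rewrite !ipE u'E // subr0.
rewrite (le_trans (cauchy_schwarz _ _)) //.
by move: uu'; rewrite ltr_pdivlMr; [have := nr_ge0 (u - u'); nra|lra].
Qed.

Lemma ortho_compl_is_subspace (E : set H) : is_subspace (ortho_compl ip E).
Proof.
by split=> [v _|a u v hu hv w Ew]; rewrite !ipE // hu // hv // mulr0 addr0.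
Qed.

(** The vectors orthogonal to [u] form a closed set that contains [E], hence also its closure. *)
Lemma closure_ortho (E : set H) u : ortho_compl ip E u -> ortho_compl ip (closure E) u.
Proof.
move=> uE v Ev; apply: ip_sym0.
have /closure_id : closed (ortho_compl ip [set u]) by exact: ortho_compl_closed.
move=> cE; suff : ortho_compl ip [set u] v by apply.
rewrite cE; apply: closureS Ev => w Ew _ ->; apply: ip_sym0; exact: uE.
Qed.

(** Existence of orthogonal projections onto [D]. It is obtained in two ways: from closedness of
    [D], and by induction on generators when [D] lies in a finite-dimensional space. *)
Definition projectable (D : set H) :=
  forall h, exists2 f, D f & ortho_compl ip D (h - f).

(* Minimising sequences are Cauchy by the parallelogram law. *)
Lemma closed_projectable (F : set H) : is_subspace F -> closed F -> projectable F.
Proof.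
move=> sF cF h; have [F0 _] := sF.
pose A := [set nr (h - f) | f in F].
have Alb : has_lbound A by exists 0 => _ [f _ <-]; exact: nr_ge0.
have Ai : has_inf A by split=> //; exists (nr (h - 0)), 0.
pose d := inf A.
have d_le f : F f -> d <= nr (h - f) by move=> Ff; apply: ge_inf => //; exists f.
have d0 : 0 <= d by apply: lb_le_inf => [|_ [f _ <-]]; [case: Ai|exact: nr_ge0].
have dnear (e : R) : 0 < e -> exists2 f, F f & nr (h - f) < d + e.
  by move=> e0; have [_ [f Ff <-] ?] := inf_adherent e0 Ai; exists f.
have /choice[x hx] : forall n : nat, exists f, F f /\ nr (h - f) < d + n.+1%:R^-1.
  by move=> n; have [|f Ff ?] := dnear n.+1%:R^-1; [rewrite invr_gt0 ltr0n|exists f].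
(* The midpoint of [f] and [g] lies in [F], so its distance to [h] is at least [d]; the
   parallelogram law converts this into a bound on |f - g|. *)
have half (f g : H) : F f -> F g ->
    nr (f - g) ^+ 2 <= 2 * nr (h - f) ^+ 2 + 2 * nr (h - g) ^+ 2 - 4 * d ^+ 2.
  move=> Ff Fg; have := parallelogram (h - g) (h - f).
  have -> : h - g - (h - f) = f - g.
    by rewrite opprB addrC addrA subrK.
  have -> : h - g + (h - f) = 2%:R%:C *: (h - 2%:R^-1%:C *: (f + g)).
    rewrite scalerBr scalerA -rmorphM /= divff ?pnatr_eq0 // scale1r.
    by rewrite rmorph_nat scaler_nat mulr2n addrACA opprD [- f - g]addrC.
  rewrite nrZ nr_real ger0_norm ?ler0n //.
  have := d_le (2%:R^-1%:C *: (f + g)) (subspaceZ sF _ (subspaceD sF Ff Fg)).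
  set t := nr (h - _ *: _); nra.
have [|l xl] := @cauchy_nr _ _ x.
  move=> e e0.
  (* For k = 1/(n+1) <= 1, (d + k)^2 <= d^2 + (2d + 1) k. The threshold on [n] makes the last term
     smaller than e^2/4, and [half] then bounds |x m - x n|^2 by e^2. *)
  have K0 : 0 < 4 * (2 * d + 1) / e ^+ 2 by rewrite divr_gt0 ?exprn_gt0 //; lra.
  have [N hN] : exists N : nat, 4 * (2 * d + 1) / e ^+ 2 < N%:R.
    by exists (truncn (4 * (2 * d + 1) / e ^+ 2)).+1; rewrite truncnS_gt.
  have bound n : (N <= n)%N -> nr (h - x n) ^+ 2 < d ^+ 2 + e ^+ 2 / 4.
    move=> Nn; have [_ lt] := hx n.
    have n0 : 0 < n.+1%:R :> R by rewrite ltr0n.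
    have : 4 * (2 * d + 1) / e ^+ 2 < n.+1%:R.
      by apply: lt_le_trans hN _; rewrite ler_nat leqW.
    rewrite ltr_pdivrMr ?exprn_gt0 // => lt2.
    have i1 : n.+1%:R^-1 <= 1 :> R by rewrite invf_le1 // ler1n.
    have i0 : 0 < n.+1%:R^-1 :> R by rewrite invr_gt0.
    have lt3 : (2 * d + 1) * n.+1%:R^-1 < e ^+ 2 / 4.
      rewrite ltr_pdivrMr //; lra.
    have := nr_ge0 (h - x n); move: i1 i0 lt3 lt; set k := n.+1%:R^-1; nra.
  exists N => m n Nm Nn; rewrite -(@ltr_pXn2r _ 2) ?nnegrE ?nr_ge0 ?ltW //.
  have := half _ _ (proj1 (hx m)) (proj1 (hx n)); have := bound m Nm; have := bound n Nn.
  lra.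
have Fl : F l.
  apply: (closed_nr cF) => e /xl[N hN]; exists (x N); first by case: (hx N).
  exact: hN.
exists l => // v Fv.
have dl : nr (h - l) <= d.
  rewrite leNgt; apply/negP => lt.
  pose e := (nr (h - l) - d) / 2; have e0 : 0 < e by rewrite /e; lra.
  have [N1 h1] := xl e e0.
  pose n := maxn N1 (truncn e^-1); have := h1 n (leq_maxl _ _).
  have [_] := hx n.
  have : n.+1%:R^-1 < e.
    rewrite -[X in _ < X]invrK ltf_pV2 ?posrE ?invr_gt0 ?ltr0n //.
    by rewrite (lt_le_trans (truncnS_gt _)) // ler_nat ltnS leq_maxr.
  have := nrD (h - x n) (x n - l); rewrite addrA subrK [nr (x n - l)]nrBC /e.
  have key (a b c k : R) :
      a <= b + c -> k < (a - d) / 2 -> b < d + k -> c < (a - d) / 2 -> False by lra.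
  exact: key.
have [->|v0] := eqVneq v 0; first by rewrite ip0r.
have iv : ip v v != 0 by rewrite dnorm_eq0.
(* Moving [l] by [a *: v] would decrease the distance to [h] by Pythagoras; since [l] is a
   minimiser, [a *: v] must vanish. *)
pose a := ip (h - l) v / ip v v.
have o : ip (h - l - a *: v) (a *: v) = 0.
  by rewrite ipZr ipDl ipNl ipZl /a divfK // subrr mulr0.
have := pythagoras o; rewrite subrK => e.
have : d <= nr (h - l - a *: v).
  rewrite -addrA -opprD; apply: d_le; apply: subspaceD => //.
  exact: subspaceZ.
move=> le; have : nr (a *: v) ^+ 2 <= 0 by have := nr_ge0 (h - l); nra.
rewrite exprn_even_le0 //= nr_eq0 scaler_eq0 (negPf v0) orbF mulf_eq0 invr_eq0.
by rewrite (negPf iv) orbF => /eqP.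
Qed.

End InnerProduct.

(** * Symmetric and selfadjoint operators *)

Section UniformBoundedness.
Context {R : realType} {H : completeNormedModType R[i]} {ip : {dot H for conjC}}.
Hypothesis hilb : norm_induced_by ip.

(* Gliding hump (Sokal): if [Y] is unbounded, a series of multiples
   [+- 3^-n y_n / |y_n|] of suitable elements of [Y] has an unbounded pairing. *)
Lemma uniform_boundedness (Y : set H) :
  (forall h, exists M : R, forall y, Y y -> nr (ip h y) <= M) ->
  exists M : R, forall y, Y y -> nr y <= M.
Proof.
move=> bnd; apply: contrapT => unb.
(* The ratio 1/3 makes the steps after the [n]-th sum to at most [c n / 2], so later terms destroy
   at most half of the pairing of size [c n * nr (y n)] secured at step [n]. *)
pose c n : R := 3 ^- n.
have c0 n : 0 < c n by rewrite invr_gt0 exprn_gt0.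
have cS n : c n = 3 * c n.+1.
  by rewrite /c exprS invfM mulrA divff // mul1r.
(* The size of [y n] is chosen so that the surviving half, [c n * nr (y n) / 2], still exceeds n +
   1. *)
have /choice[y hy] : forall n : nat, exists y, Y y /\ 2 * n.+1%:R / c n < nr y.
  move=> n; apply: contrapT => no; apply: unb; exists (2 * n.+1%:R / c n) => y Yy.
  by rewrite leNgt; apply/negP => lt; apply: no; exists y.
have y0 n : 0 < nr (y n).
  by have [_] := hy n; apply: lt_trans; rewrite divr_gt0 // mulr_gt0.
pose v n : H := (c n / nr (y n))%:C *: y n.
have nv n : nr (v n) = c n.
  by rewrite nrZ nr_real ger0_norm ?divr_ge0 ?ltW // divfK // gt_eqF.
have vy n : nr (ip (v n) (y n)) = c n * nr (y n).
  rewrite ipZl (ip_nr hilb) nrM !nr_real !ger0_norm ?sqr_ge0 ?divr_ge0 ?ltW //.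
  by rewrite expr2 mulrA divfK // gt_eqF.
(* The pairings of [x + v n] and [x - v n] with [y n] differ by twice that of [v n], so at least one
   of the two signs gives the required size. *)
pose step n x := if c n * nr (y n) <= nr (ip (x + v n) (y n)) then x + v n else x - v n.
have step_ip n x : c n * nr (y n) <= nr (ip (step n x) (y n)).
  rewrite /step; case: ifPn => //; rewrite -ltNge => lt.
  have := nrB (ip (x + v n) (y n)) (ip (x - v n) (y n)).
  have -> : ip (x + v n) (y n) - ip (x - v n) (y n) = 2 * ip (v n) (y n).
    by rewrite !ipE; ring.
  by rewrite nrM vy nr_nat; lra.
have step_nr n x : nr (step n x - x) = c n.
  by rewrite /step; case: ifP => _; rewrite addrC addKr ?nrN nv.
pose x : nat -> H := nat_rect (fun=> H) 0 step.
have xS n : x n.+1 = step n (x n) by [].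
have x_near n k : nr (x (n + k)%N - x n) <= 3 / 2 * (c n - c (n + k)%N).
  elim: k => [|k IH]; first by rewrite addn0 !subrr nr0 mulr0.
  rewrite addnS -(subrK (x (n + k)%N) (x (n + k).+1)) -addrA (le_trans (nrD _ _)) //.
  by rewrite xS step_nr; have := cS (n + k)%N; lra.
have x_near' m n : (n <= m)%N -> nr (x m - x n) <= 3 / 2 * c n.
  by move=> nm; rewrite -(subnKC nm) (le_trans (x_near _ _)) //; have := c0 (n + (m - n))%N; lra.
have csmall n : c n <= (n.+1%:R : R)^-1.
  rewrite /c lef_pV2 ?posrE ?exprn_gt0 ?ltr0n // -natrX ler_nat.
  exact: ltn_expl.
have [|l xl] := @cauchy_nr _ _ x.
  move=> e e0; have [|N hN] := @inv_succ_small _ (e / 3); first lra.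
  exists N => m n Nm Nn.
  have := nrB (x m - x N) (x n - x N); rewrite opprB addrA subrK.
  have := x_near' _ _ Nm; have := x_near' _ _ Nn; have := le_lt_trans (csmall N) (hN N (leqnn N)).
  lra.
have l_near n : nr (l - x n.+1) <= c n / 2.
  rewrite leNgt; apply/negP => lt.
  have [|N hN] := xl (nr (l - x n.+1) - c n / 2); first lra.
  have := hN _ (leq_maxl N n.+1); have := x_near' _ _ (leq_maxr N n.+1).
  have := nrD (l - x (maxn N n.+1)) (x (maxn N n.+1) - x n.+1).
  rewrite addrA subrK; have := cS n; lra.
have [M hM] := bnd l.
have [yn lt] := hy (truncn M).
have := hM _ yn.
have := cauchy_schwarz hilb (l - x (truncn M).+1) (y (truncn M)).
have := step_ip (truncn M) (x (truncn M)); rewrite -xS.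
have := nrB (ip l (y (truncn M))) (ip (l - x (truncn M).+1) (y (truncn M))).
rewrite -[in X in X <= _]ipNl opprB -ipDl addrC subrK.
have := truncnS_gt M; have := ler_wpM2r (ltW (y0 (truncn M))) (l_near (truncn M)).
move: lt; set n := truncn M; rewrite ltr_pdivrMr //; lra.
Qed.

End UniformBoundedness.

Section Operators.
Context {R : realType} {H : completeNormedModType R[i]} {ip : {dot H for conjC}}.
Hypothesis hilb : norm_induced_by ip.
Implicit Types A S : operator H H.

(** By continuity of the inner product. Adjoint graphs are intersections of such sets, and
    identities valid on a graph pass to its closure. *)
Lemma closed_ip_eq (a b : H) : closed [set p : H * H | ip a p.1 = ip b p.2].
Proof.
move=> [x y] /closure_prod_nr h /=; apply/eqP; rewrite -subr_eq0; apply/eqP.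
apply: nr_ip_eq0 => e e0; have a0 := nr_ge0 a; have b0 := nr_ge0 b.
have [|[x' y'] /= xy' [xx' yy']] := h (e / (nr a + nr b + 1)).
  by rewrite divr_gt0 //; lra.
have -> : ip a x - ip b y = ip a (x - x') - ip b (y - y').
  by rewrite !ipE xy'; ring.
rewrite (le_trans (nrB _ _)) //.
have := cauchy_schwarz hilb a (x - x'); have := cauchy_schwarz hilb b (y - y').
move: xx' yy'; rewrite !ltr_pdivlMr; try lra.
have := nr_ge0 (x - x'); have := nr_ge0 (y - y'); nra.
Qed.

Lemma adjoint_graph_closed A : closed (adjoint_graph ip A).
Proof.
move=> p clp u Au.
have /closure_id E := @closed_ip_eq (A u) u.
suff : [set p : H * H | ip (A u) p.1 = ip u p.2] p by [].
by rewrite E; apply: closureS clp => q; apply.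
Qed.

Lemma selfadjoint_closed A : selfadjoint_operator ip A -> closed_operator A.
Proof. by move=> [_ E]; rewrite /closed_operator E; exact: adjoint_graph_closed. Qed.

Lemma selfadjoint_symmetric A : selfadjoint_operator ip A -> symmetric_operator ip A.
Proof.
move=> [_ E] u v Au Av; have : graph A (v, A v) by exists v.
by rewrite E => /(_ u Au).
Qed.

Lemma eigenspace_is_subspace A (z : R[i]) :
  linear_operator A -> is_subspace (op_eigenspace A z).
Proof.
move=> [sA lA]; split=> [|a u v [Du hu] [Dv hv]].
  by split; [case: sA|rewrite (linear_on0 sA lA) scaler0].
split; first exact: (proj2 sA).
by rewrite lA // hu hv scalerDr !scalerA mulrC.
Qed.

Lemma eigenspace_closed A (z : R[i]) : closed_operator A -> closed (op_eigenspace A z).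
Proof.
move=> cA u /closure_nr h.
suff [u' Du' [eu eA]] : graph A (u, z *: u) by rewrite -eu in eA *; split.
apply/cA/closure_prod_nr => e e0; have z0 := nr_ge0 z.
have [|u' [Du' Au'] uu'] := h (e / (nr z + 1)); first by rewrite divr_gt0 //; lra.
exists (u', A u'); first by exists u'.
rewrite /= Au' -scalerBr nrZ; move: uu'; rewrite ltr_pdivlMr; last lra.
by have := nr_ge0 (u - u'); split; nra.
Qed.

Section Symmetric.
Variables (A : operator H H) (a eta : R).
Hypotheses (linA : linear_operator A) (symA : symmetric_operator ip A).
Let z : R[i] := a%:C + 'i%R * eta%:C.

Lemma conj_shift : conjC z = a%:C + 'i%R * (- eta)%:C.
Proof.
by rewrite /z rmorphD rmorphM /= !conjC_realC conjCi rmorphN mulNr mulrN.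
Qed.

(** The cross terms cancel because symmetry makes ((A - a) u, u) real. *)
Lemma shift_norm u : dom A u ->
  nr (A u - z *: u) ^+ 2 = nr (A u - a%:C *: u) ^+ 2 + eta ^+ 2 * nr u ^+ 2.
Proof.
move=> Du.
have : ip (A u - z *: u) (A u - z *: u) =
    ip (A u - a%:C *: u) (A u - a%:C *: u) + (eta%:C) ^+ 2 * ip u u.
  have := symA Du Du; rewrite !ipE conj_shift !conjC_realC /z rmorphN /= => ->.
  have : 'i%R ^+ 2 = -1 :> R[i] by rewrite sqrCi.
  move: ('i%R : R[i]) (a%:C) (eta%:C) => i a' b h; ring: h.
by rewrite !(ip_nr hilb) -rmorphXn -rmorphM -rmorphD => /complexI.
Qed.

Lemma shift_lower_bound u : dom A u -> `|eta| * nr u <= nr (A u - z *: u).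
Proof.
move=> /shift_norm e.
rewrite -(@ler_pXn2r _ 2) ?nnegrE ?nr_ge0 ?mulr_ge0 ?nr_ge0 // e exprMn real_normK ?num_real //.
by rewrite lerDr sqr_ge0.
Qed.

Lemma shift_range_is_subspace : is_subspace [set A u - z *: u | u in dom A].
Proof.
by case: linA => sA lA; apply: linear_on_image => //; apply: linear_on_shift.
Qed.

Hypothesis eta0 : eta != 0.

Lemma shift_inj u : dom A u -> A u - z *: u = 0 -> u = 0.
Proof.
move=> Du e; have := shift_lower_bound Du; rewrite e nr0 => le.
by apply: nr_le0; rewrite -(pmulr_rle0 _ (_ : 0 < `|eta|)) // normr_gt0.
Qed.

(** By the lower bound, preimages of a convergent sequence in the range are Cauchy; closedness of
    [A] puts the limit pair in the graph. *)
Lemma shift_range_closed : closed_operator A -> closed [set A u - z *: u | u in dom A].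
Proof.
case: (linA) => sA lA cA; apply: closed_seq => y s hs sy.
have /choice[u hu] : forall n, exists u, dom A u /\ A u - z *: u = s n.
  by move=> n; have [u Du <-] := hs n; exists u.
have n0 : 0 < `|eta| by rewrite normr_gt0.
have [|l ul] := @cauchy_nr _ _ u.
  move=> e e0; have [|N hN] := sy (`|eta| * e / 2); first by rewrite divr_gt0 // mulr_gt0.
  exists N => m n Nm Nn; have [[Dm em] [Dn en]] := (hu m, hu n).
  have := shift_lower_bound (subspaceB sA Dm Dn).
  have -> : A (u m - u n) - z *: (u m - u n) = (y - s n) - (y - s m).
    rewrite (linear_onB lA) // -em -en.
    by apply: (ip_ext (ip := ip)) => w; rewrite !ipE; ring.
  move=> le; have := nrB (y - s n) (y - s m); have := hN _ Nm; have := hN _ Nn.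
  by rewrite -[_ < e](ltr_pM2l n0); lra.
suff [u' Du' [<- e]] : graph A (l, y + z *: l) by exists u' => //; rewrite e addrK.
apply/cA/closure_prod_nr => e e0; have z0 := nr_ge0 z.
have [|N1 h1] := ul (e / (nr z + 2)); first by rewrite divr_gt0 //; lra.
have [|N2 h2] := sy (e / (nr z + 2)); first by rewrite divr_gt0 //; lra.
pose n := maxn N1 N2; have [Dn en] := hu n.
exists (u n, A (u n)); first by exists (u n).
have := h1 n (leq_maxl _ _); have := h2 n (leq_maxr _ _); rewrite !ltr_pdivlMr; try lra.
have -> : y + z *: l - A (u n) = (y - s n) + z *: (l - u n).
  by rewrite -en; apply: (ip_ext (ip := ip)) => w; rewrite !ipE; ring.
have := nrD (y - s n) (z *: (l - u n)); rewrite nrZ.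
by have := nr_ge0 (l - u n); have := nr_ge0 (y - s n); split; nra.
Qed.

(** One inclusion of the classical identity between the complement of ran (A - z) and the kernel of
    A^* minus the conjugate of z. It is applied both with [eta] nonzero and with [eta = 0]. *)
Lemma ortho_shift_range k : ortho_compl ip [set A u - z *: u | u in dom A] k ->
  adjoint_graph ip A (k, conjC z *: k).
Proof.
move=> h u Du /=; have /ip_sym0 : ip k (A u - z *: u) = 0 by apply: h; exists u.
by rewrite !ipE conjCK => /eqP; rewrite subr_eq0 => /eqP.
Qed.

End Symmetric.

(** The range is closed, and a vector orthogonal to it is an eigenvector of A^* = A at a nonreal
    point, hence zero. *)
Lemma selfadjoint_shift_surj A (a eta : R) : linear_operator A ->
  selfadjoint_operator ip A -> eta != 0 ->
  forall h, exists2 u, dom A u & A u - (a%:C + 'i%R * eta%:C) *: u = h.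
Proof.
move=> linA saA eta0 h; have symA := selfadjoint_symmetric saA.
have clr := shift_range_closed (a := a) linA symA eta0 (selfadjoint_closed saA).
have [_ [u Du <-]] := closed_projectable hilb (shift_range_is_subspace a eta linA) clr h.
move=> /ortho_shift_range; case: (saA) => _ <- [k Dk [ek Ak]]; exists u => //.
apply/esym/eqP; rewrite -subr_eq0 -ek; apply/eqP.
apply: (shift_inj (eta := - eta) (a := a) symA _ Dk); first by rewrite oppr_eq0.
by rewrite -conj_shift Ak ek subrr.
Qed.

(* S** = S for closed symmetric S. *)
Lemma biadjoint S u v : linear_operator S -> closed_operator S ->
  symmetric_operator ip S -> adjoint_graph ip S (u, v) ->
  (forall p, adjoint_graph ip S p -> ip v p.1 = ip u p.2) -> dom S u /\ S u = v.
Proof.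
move=> linS clS symS adj biadj.
have one0 : 1 != 0 :> R by exact: oner_neq0.
have clr := shift_range_closed (a := 0) linS symS one0 clS.
have z_i : (0 : R)%:C + 'i%R * (1 : R)%:C = 'i%R :> R[i].
  by rewrite rmorph1 rmorph0 add0r mulr1.
have [_ [s Ds <-]] :=
  closed_projectable hilb (shift_range_is_subspace 0 1 linS) clr (v - 'i%R *: u).
(* The part [k] of [v - 'i *: u] orthogonal to ran (S - i) satisfies S^* k = -i k. Testing the
   biadjoint condition on this pair gives (k, k) = 0, so [v - 'i *: u] equals (S - i) s. *)
move=> kF; have := ortho_shift_range kF; rewrite z_i conjCi in kF *.
move: kF; move kE : (v - 'i%R *: u - (S s - 'i%R *: s)) => k kF /biadj /= kv.
have k0 : k = 0.
  apply: (ip_eq0 (ip := ip)); rewrite -{1}kE ipDl ipNl.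
  rewrite (ip_sym0 (kF (S s - 'i%R *: s) _)); last by exists s.
  by rewrite !ipE kv !ipE rmorphN /= conjCi; ring.
have e : v = S s + 'i%R *: (u - s).
  move/eqP: kE; rewrite k0 subr_eq0 => /eqP e.
  apply: (ip_ext (ip := ip)) => w; move/(congr1 (ip ^~ w)): e; rewrite !ipE.
  by move/eqP; rewrite subr_eq => /eqP ->; ring.
have adjs : adjoint_graph ip S (s, S s) by move=> w Dw /=; exact: symS.
(* The defect [u - s] is an eigenvector of S^* at i. The biadjoint condition for it reads 2i |u -
   s|^2 = 0. *)
have adjd : adjoint_graph ip S (u - s, 'i%R *: (u - s)).
  move=> w Dw; have /= := adj w Dw; have /= := adjs w Dw; rewrite e !ipE => -> ->.
  by ring.
have := biadj _ adjd; rewrite /= {1}e ipDl (adjd s Ds) /=.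
have du : ip u (u - s) = ip (u - s) (u - s) + ip s (u - s).
  by rewrite -ipDl subrK.
move: du; move dE : (u - s) => d du.
rewrite !(ipZl, ipZr) du conjCi => /eqP; rewrite -subr_eq0.
rewrite (_ : _ - _ = 'i%R *+ 2 * ip d d); last by rewrite -mulr_natr; ring.
rewrite mulf_eq0 mulrn_eq0 /= (negPf (neq0Ci _)) /= => /eqP dd.
have /eqP := ip_eq0 dd; rewrite -dE subr_eq0 => /eqP us.
by rewrite e us subrr scaler0 addr0.
Qed.

End Operators.

(** * Finite-dimensional subspaces *)

Section FiniteDimension.
Context {R : realType} {H : completeNormedModType R[i]} {ip : {dot H for conjC}}.

Let span n (e : 'I_n -> H) : set H :=
  [set \sum_(i < n) c i *: e i | c in [set: 'I_n -> R[i]]].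

Lemma span_is_subspace n (e : 'I_n -> H) : is_subspace (span e).
Proof.
split=> [|a _ _ [c _ <-] [c' _ <-]].
  by exists (fun=> 0) => //; rewrite big1 // => i _; rewrite scale0r.
exists (fun i => a * c i + c' i) => //.
by rewrite scaler_sumr -big_split /=; apply: eq_bigr => i _; rewrite scalerDl scalerA.
Qed.

Lemma span_recr n (e : 'I_n.+1 -> H) u : span e u ->
  exists2 s, span (e \o widen_ord (leqnSn n)) s & exists c, u = s + c *: e ord_max.
Proof.
move=> [c _ <-]; rewrite big_ord_recr /=.
exists (\sum_(i < n) c (widen_ord (leqnSn n) i) *: e (widen_ord (leqnSn n) i)).
  by exists (c \o widen_ord (leqnSn n)).
by exists (c ord_max).
Qed.

(** Induction on the number of generators. If [D] is not inside the span of the first [n], it is the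
    orthogonal sum of its intersection with that span and one line, generated by [d1]; the two
    projections add up. *)
Lemma span_projectable n (e : 'I_n -> H) (D : set H) :
  is_subspace D -> D `<=` span e -> projectable (ip := ip) D.
Proof.
elim: n e D => [|n IH] e D sD De h.
  exists 0; first by case: sD.
  by move=> d /De[c _ <-]; rewrite big_ord0 ip0r.
pose e' := e \o widen_ord (leqnSn n).
have sE := span_is_subspace e'.
have [sub|] := pselect (D `<=` span e'); first exact: (IH e').
move=> /existsNP[d0 /not_implyP[Dd0 nd0]].
have sD' : is_subspace (D `&` span e').
  split; first by split; [case: sD|case: sE].
  by move=> a u v [Du eu] [Dv ev]; split; [apply: (proj2 sD)|apply: (proj2 sE)].
have {}IH := IH e' _ sD' (@subIsetr _ _ _).
have [p0 [Dp0 ep0] op0] := IH d0; have [p [Dp ep] op] := IH h.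
move: op0; move d1E : (d0 - p0) => d1 op0.
have Dd1 : D d1 by rewrite -d1E; exact: subspaceB.
have nd1 : ~ span e' d1.
  by move=> ed1; apply: nd0; rewrite -(subrK p0 d0) d1E; exact: subspaceD.
have id1 : ip d1 d1 != 0.
  rewrite dnorm_eq0; apply/eqP => d10; apply: nd1; rewrite d10; exact: (proj1 sE).
have [s es [c dc]] := span_recr (De _ Dd1).
have c0 : c != 0 by apply/eqP => c0; apply: nd1; rewrite dc c0 scale0r addr0.
pose a := ip h d1 / ip d1 d1.
exists (p + a *: d1); first by apply: subspaceD => //; exact: subspaceZ.
move=> d Dd; have [s' es' [c' dc']] := span_recr (De _ Dd).
(* Subtracting this multiple of [d1] cancels the coefficient of the last generator. *)
have D'd : (D `&` span e') (d - (c' / c) *: d1).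
  split; first by apply: subspaceB => //; exact: subspaceZ.
  rewrite dc dc' scalerDr scalerA divfK // opprD addrACA subrr addr0.
  by apply: subspaceB => //; exact: subspaceZ.
rewrite -(subrK ((c' / c) *: d1) d) ipDr ipZr.
rewrite opprD addrA (ipDl (h - p)) op // ipNl ipZl op0 // mulr0 oppr0 add0r.
rewrite !(ipDl, ipNl, ipZl) /a divfK // (ip_sym0 (op0 p _)) //.
by ring.
Qed.

Lemma finite_dim_projectable (E D : set H) : finite_dim E -> is_subspace D ->
  D `<=` E -> projectable (ip := ip) D.
Proof. by move=> [n [e ->]]; exact: span_projectable. Qed.

End FiniteDimension.

(** * Quasi boundary triples *)

Section BoundaryTriple.
Context {R : realType} {H G : completeNormedModType R[i]}.
Context {ipH : {dot H for conjC}} {ipG : {dot G for conjC}}.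
Hypotheses (hilbH : norm_induced_by ipH) (hilbG : norm_induced_by ipG).
Context {S T : operator H H} {Gamma0 Gamma1 : H -> G}.
Hypotheses (linS : linear_operator S) (clS : closed_operator S)
  (symS : symmetric_operator ipH S)
  (qbt : quasi_boundary_triple ipH ipG S T Gamma0 Gamma1).

Let A0 := A0_of T Gamma0.
Let linT := qbt_linear_T qbt.
Let sT := proj1 linT.
Let lT := proj2 linT.
Let lG0 := qbt_linear_Gamma0 qbt.
Let lG1 := qbt_linear_Gamma1 qbt.
Let green := qbt_green qbt.
Let saA0 : selfadjoint_operator ipH A0 := qbt_selfadjoint qbt.

Lemma linear_A0 : linear_operator A0.
Proof.
split; last by move=> a u v [Du _] [Dv _]; exact: lT.
split; first by split; [case: sT|exact: (linear_on0 sT lG0)].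
move=> a u v [Du /= u0] [Dv /= v0]; split; first exact: (proj2 sT).
by rewrite /= lG0 // u0 v0 scaler0 addr0.
Qed.

Let symA0 := selfadjoint_symmetric saA0.
Let sA0 := proj1 linear_A0.
Let lA0 : linear_on (dom A0) T := proj2 linear_A0.

Lemma closure_range_Gamma0 g : closure (Gamma0 @` dom T) g.
Proof.
apply/closure_nr => e e0.
have /closure_prod_nr/(_ e e0)[_ [u Du <-] [gu _]] :
    closure [set (Gamma0 u, Gamma1 u) | u in dom T] (g, 0).
  move=> B; rewrite nbhsE => -[C [oC Cg] CB].
  have [|q [Cq qT]] := qbt_dense_range qbt _ oC; first by exists (g, 0).
  by exists q; split=> //; exact: CB.
by exists (Gamma0 u) => //; exists u.
Qed.

Lemma ortho_range_Gamma0 x : (forall u, dom T u -> ipG x (Gamma0 u) = 0) -> x = 0.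
Proof.
move=> h; apply: (ip_eq0 (ip := ipG)).
suff /(closure_ortho hilbG) : ortho_compl ipG (Gamma0 @` dom T) x.
  by apply; exact: closure_range_Gamma0.
by move=> _ [u Du <-]; exact: h.
Qed.

(** Since T is a restriction of S^*, the pair (u, S u) lies in the adjoint graph of A0, which is the
    graph of A0. Green's identity then makes [Gamma1 u] orthogonal to the dense range of
    [Gamma0]. *)
Lemma S_sub_T u : dom S u -> [/\ dom T u, T u = S u, Gamma0 u = 0 & Gamma1 u = 0].
Proof.
move=> Su.
have adjS v : dom T v -> ipH (S u) v = ipH u (T v).
  by move=> Dv; apply: (qbt_sub_adjoint qbt (_ : graph T (v, T v)) Su); exists v.
have [u' [Du' u'0] [eu eSu]] : graph A0 (u, S u).
  by rewrite (proj2 saA0) => v [Dv _] /=; rewrite ipC -adjS // -ipC.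
rewrite /= in eu eSu u'0; rewrite eu in eSu u'0 Du'.
split=> //; apply: ortho_range_Gamma0 => v Dv.
have := green Du' Dv; rewrite u'0 ip0l subr0 => <-.
by rewrite eSu adjS // subrr.
Qed.

(** Green's identity has no boundary terms at [u], so (T u, v) = (u, T v) on dom T. This extends to
    the closure S^* of T, and S** = S finishes. *)
Lemma S_of_boundary0 u : dom T u -> Gamma0 u = 0 -> Gamma1 u = 0 -> dom S u /\ S u = T u.
Proof.
move=> Du u0 u1.
apply: (biadjoint hilbH linS clS symS); first by apply: (qbt_sub_adjoint qbt); exists u.
move=> p; rewrite -(qbt_closure qbt) => clp.
have /closure_id E := @closed_ip_eq _ _ _ hilbH (T u) u.
suff : [set p : H * H | ipH (T u) p.1 = ipH u p.2] p by [].
rewrite E; apply: closureS clp => _ [v Dv <-] /=.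
apply/eqP; rewrite -subr_eq0 green // u0 u1 !ip0l subrr; exact/eqP.
Qed.

Lemma eigenspace_S (mu : R[i]) u :
  op_eigenspace S mu u <-> op_eigenspace A0 mu u /\ Gamma1 u = 0.
Proof.
split=> [[/S_sub_T[Du e u0 u1] h]|[[[Du u0] e] u1]].
  by split=> //; split=> //; rewrite /= e.
by have [Su eS] := S_of_boundary0 Du u0 u1; split; rewrite // eS.
Qed.

(** * The Weyl function near a real point *)

Section Point.
Variable lambda : R.
Let z (eta : R) : R[i] := lambda%:C + 'i%R * eta%:C.

(** This is the splitting of dom T into ker Gamma0 and ker (T - z): subtract from [w] the vector (A0
    - z)^-1 (T - z) w, on which [Gamma0] vanishes. *)
Lemma eigenvector_lift eta w : eta != 0 -> dom T w ->
  exists2 u, op_eigenspace T (z eta) u & Gamma0 u = Gamma0 w.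
Proof.
move=> eta0 Dw.
have [r [Dr r0] er] := selfadjoint_shift_surj hilbH lambda linear_A0 saA0 eta0 (T w - z eta *: w).
exists (w - r); last by rewrite (linear_onB lG0) // r0 subr0.
split; first exact: subspaceB.
rewrite (linear_onB lT) //; move/eqP: er; rewrite subr_eq => /eqP /= ->.
by apply: (ip_ext (ip := ipH)) => v; rewrite !ipE /z; ring.
Qed.

(** Since [z (-1)] is the conjugate of [z 1], the left side of Green's identity collapses to one
    pairing. It expresses the duality between the gamma-field at [z 1] and Gamma1 (A0 - z
    (-1))^-1. *)
Lemma green_eigenvector x y : dom A0 x -> op_eigenspace T (z 1) y ->
  ipH (T x - z (-1) *: x) y = ipG (Gamma1 x) (Gamma0 y).
Proof.
move=> [Dx x0] [Dy ey]; have := green Dx Dy.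
by rewrite x0 ip0l subr0 ey ipZr conj_shift => <-; rewrite !ipE.
Qed.

(* [Gamma1 (A0 - z)^-1] is bounded, being the adjoint of the gamma-field at the
   conjugate point. *)
Lemma Gamma1_bounded : exists2 C : R, 0 <= C &
  forall x, dom A0 x -> nr (Gamma1 x) <= C * nr (T x - z (-1) *: x).
Proof.
have one0 : 1 != 0 :> R by exact: oner_neq0.
have m10 : -1 != 0 :> R by rewrite oppr_eq0.
(* Lifts of boundary values of norm at most 2. By [green_eigenvector] and solvability of (A0 - z
   (-1)) x = h they are weakly bounded. The bound 2 leaves room for approximating a unit vector
   within 1/2. *)
pose Y := [set y | op_eigenspace T (z 1) y /\ nr (Gamma0 y) <= 2].
have [|M hM] := uniform_boundedness hilbH (Y := Y).
  move=> h; have [x Dx <-] := selfadjoint_shift_surj hilbH lambda linear_A0 saA0 m10 h.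
  exists (nr (Gamma1 x) * 2) => y [ey y2].
  rewrite (green_eigenvector Dx ey) (le_trans (cauchy_schwarz hilbG _ _)) //.
  by rewrite ler_wpM2l ?nr_ge0.
have M0 : 0 <= M.
  apply: le_trans (hM 0 _); first exact: nr_ge0.
  split; first by split; [case: sT|rewrite (linear_on0 sT lT) scaler0].
  by rewrite (linear_on0 sT lG0) nr0.
exists (2 * M); first by lra.
move=> x Dx.
have [->|x0] := eqVneq (Gamma1 x) 0; first by rewrite nr0 !mulr_ge0 ?nr_ge0.
have n0 : 0 < nr (Gamma1 x) by rewrite nr_gt0.
(* Pairing [Gamma1 x] with its own direction returns its norm; replacing [g] by a nearby value of
   [Gamma0] loses at most half of it, whence the factor 2 in the constant. *)
pose g := (nr (Gamma1 x))^-1%:C *: Gamma1 x.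
have ng : nr g = 1 by rewrite nrZ nr_real ger0_norm ?invr_ge0 ?nr_ge0 // mulVf // gt_eqF.
have /closure_nr/(_ 2^-1)[|_ [w Dw <-] lt] := @closure_range_Gamma0 g; first by lra.
have [y ey e] := eigenvector_lift one0 Dw; rewrite -e in lt.
have Yy : Y y.
  split=> //; have := nrB g (g - Gamma0 y); rewrite opprB addrC subrK ng; lra.
have := cauchy_schwarz hilbH (T x - z (-1) *: x) y.
rewrite (green_eigenvector Dx ey).
have := cauchy_schwarz hilbG (Gamma1 x) (g - Gamma0 y).
have := nrD (ipG (Gamma1 x) (Gamma0 y)) (ipG (Gamma1 x) (g - Gamma0 y)).
rewrite -ipDr addrC subrK {1}/g ipZr conjC_realC (ip_nr hilbG) -rmorphM /=.
rewrite nr_real expr2 mulrA mulVf ?gt_eqF // mul1r ger0_norm ?nr_ge0 //.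
have := hM _ Yy; have := ler_wpM2l (nr_ge0 (T x - z (-1) *: x)) (hM _ Yy).
have := ler_wpM2l (ltW n0) (ltW lt); lra.
Qed.

(** A quantitative mean ergodic estimate: approximating [f] by (A0 - lambda) v leaves an error of
    order [eta] and one controlled by the distance of [f] to the range. *)
Lemma weyl_cvg w f p : dom T w ->
  closure [set T v - lambda%:C *: v | v in dom A0] f -> op_eigenspace A0 lambda%:C p ->
  T w - lambda%:C *: w = f + p ->
  ('i%R * eta%:C) *: weyl T Gamma0 Gamma1 (z eta) (Gamma0 w) @[eta --> (0 : R)^'+]
    --> Gamma1 p.
Proof.
move=> Dw /closure_nr clf [[Dp p0] /= ep] ew.
have [C C0 hC] := Gamma1_bounded.
apply: cvg_nr => e e0.
have [|_ [v [Dv v0] <-] fv] := clf (e / (4 * (C + 1))); first by rewrite divr_gt0 //; lra.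
(* [K] collects the coefficients of [eta] in the final estimate; the remaining error, from
   approximating [f], is at most e/2. *)
pose K := nr (Gamma1 w) + C * (nr f + 3 * nr w + 4 * nr v).
have K0 : 0 <= K.
  by rewrite /K addr_ge0 ?nr_ge0 // mulr_ge0 // !addr_ge0 ?mulr_ge0 ?nr_ge0.
have d0 : 0 < e / (2 * (K + 1)) by rewrite divr_gt0 //; lra.
near=> eta.
have eta0 : 0 < eta by near: eta; exact: nbhs_right_gt.
have eta1 : eta < 1 by near: eta; exact: nbhs_right_lt.
have etad : eta < e / (2 * (K + 1)) by near: eta; exact: nbhs_right_lt.
(* A preimage exists, so [pinv] returns a genuine one. Only the two properties of [u] derived next
   are used, and the choice is then forgotten. *)
have gw : (Gamma0 @` op_eigenspace T (z eta)) (Gamma0 w).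
  by have [u eu <-] := eigenvector_lift (lt0r_neq0 eta0) Dw; exists u.
rewrite /weyl /gamma_field /=; set u := 'pinv_(_) _ _ _.
have u0 : Gamma0 u = Gamma0 w by rewrite /u pinvK // inE.
have [Du eu] : op_eigenspace T (z eta) u.
  have sur : set_surj (op_eigenspace T (z eta)) (Gamma0 @` op_eigenspace T (z eta)) Gamma0.
    by [].
  by apply: (surjpinv_image_sub (dflt := fun=> 0) sur); exists (Gamma0 w).
clearbody u.
pose t := 'i%R * eta%:C : R[i].
have nt : nr t = eta by rewrite nrM nr_i nr_real mul1r gtr0_norm.
(* This vector lies in dom A0 and measures the distance of i eta r from its limit - p, with r = w -
   u. It has to tend to 0 in the graph norm of A0. *)
pose x := t *: (w - u) + p.
have Dwu : dom T (w - u) by exact: subspaceB.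
have Dx : dom A0 x.
  split; first by apply: (proj2 sT).
  by rewrite /= lG0 // p0 (linear_onB lG0) // u0 subrr scaler0 addr0.
have G1x : Gamma1 x = t *: Gamma1 w - t *: Gamma1 u + Gamma1 p.
  by rewrite /x lG1 // (linear_onB lG1) // scalerBr.
have Tw : T w = lambda%:C *: w + (f + p) by rewrite -ew addrC subrK.
have ex : T x - z eta *: x = t *: (f - t *: w).
  rewrite /x lT // (linear_onB lT) // eu ep Tw.
  by apply: (ip_ext (ip := ipH)) => h; rewrite !ipE /z /t; ring.
(* Correcting by [t *: v] replaces [f] in (A0 - z) x by a small remainder up to order [eta], so a
   factor [eta] cancels against the lower bound for A0 - z. *)
have Dy : dom A0 (x - t *: v) by apply: (subspaceB sA0) => //; exact: (subspaceZ sA0).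
have ey : T (x - t *: v) - z eta *: (x - t *: v) =
    t *: ((f - (T v - lambda%:C *: v)) - t *: w + t *: v).
  rewrite (linear_onB lA0) //; last exact: (subspaceZ sA0).
  rewrite (linear_onZ sA0 lA0) //.
  move/eqP: ex; rewrite subr_eq => /eqP ->.
  by apply: (ip_ext (ip := ipH)) => h; rewrite !ipE /z /t; ring.
have ny : nr (x - t *: v) <= e / (4 * (C + 1)) + eta * nr w + eta * nr v.
  have := shift_lower_bound hilbH lambda eta symA0 Dy.
  rewrite -/(z eta) /= ey nrZ nt gtr0_norm // ler_pM2l // => /le_trans; apply.
  rewrite (le_trans (nrD _ _)) // nrZ nt lerD2r (le_trans (nrB _ _)) // nrZ nt.
  by rewrite lerD2r ltW.
have nx : nr x <= e / (4 * (C + 1)) + eta * nr w + 2 * (eta * nr v).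
  by have := nrD (x - t *: v) (t *: v); rewrite subrK nrZ nt; lra.
have bx : nr (T x - z (-1) *: x) <= eta * nr f + eta * nr w + 2 * nr x.
  have -> : T x - z (-1) *: x = t *: (f - t *: w) + ('i%R * (eta + 1)%:C) *: x.
    by rewrite -ex; apply: (ip_ext (ip := ipH)) => h; rewrite !ipE /z rmorphD rmorphN; ring.
  rewrite (le_trans (nrD _ _)) // !nrZ nt nrM nr_i nr_real mul1r ger0_norm; last by lra.
  have := ler_wpM2l (ltW eta0) (nrB f (t *: w)); rewrite nrZ nt.
  have := ler_wpM2r (nr_ge0 x) (ltW eta1).
  have := ler_wpM2r (mulr_ge0 (ltW eta0) (nr_ge0 w)) (ltW eta1); lra.
have -> : Gamma1 p - t *: Gamma1 u = Gamma1 x - t *: Gamma1 w.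
  by rewrite G1x addrAC [_ *: Gamma1 w - _]addrC addrK [in RHS]addrC.
rewrite (le_lt_trans (nrB _ _)) // nrZ nt.
have bC : C * (e / (4 * (C + 1))) <= e / 4.
  rewrite mulrA ler_pdivrMr; last by lra.
  by rewrite mulrA divfK // mulrC ler_wpM2l ?ltW //; lra.
move: etad; rewrite ltr_pdivlMr; last by lra.
have := hC _ Dx; have := ler_wpM2l C0 bx; have := ler_wpM2l C0 nx.
have := mulr_ge0 (ltW eta0) (nr_ge0 w); have := mulr_ge0 (ltW eta0) (nr_ge0 v).
move: K0; rewrite /K; lra.
Unshelve. all: by end_near. Qed.

Lemma weyl_residueE w f p : dom T w ->
  closure [set T v - lambda%:C *: v | v in dom A0] f -> op_eigenspace A0 lambda%:C p ->
  T w - lambda%:C *: w = f + p ->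
  weyl_residue T Gamma0 Gamma1 lambda (Gamma0 w) = Gamma1 p.
Proof.
move=> Dw clf ep ew; apply: cvg_lim; first exact: norm_hausdorff.
exact: weyl_cvg Dw clf ep ew.
Qed.

(** * The range of the residue and its relation to K *)

Let K := ominus ipH (op_eigenspace A0 lambda%:C) (op_eigenspace S lambda%:C).
Let RM := weyl_residue T Gamma0 Gamma1 lambda.

Lemma ominus_is_subspace : is_subspace K.
Proof.
have [N0 ND] := eigenspace_is_subspace lambda%:C linear_A0.
have [z0 OD] := ortho_compl_is_subspace (ip := ipH) (op_eigenspace S lambda%:C).
by split=> [|a u v [Nu Ou] [Nv Ov]]; split; [| |exact: ND|exact: OD].
Qed.

Lemma ominus_closed : closed K.
Proof.
apply: closedI; last exact: ortho_compl_closed.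
exact/eigenspace_closed/(selfadjoint_closed hilbH).
Qed.

Lemma Gamma1_ker u : K u -> Gamma1 u = 0 -> u = 0.
Proof.
move=> [Nu Ou] u1; apply: (ip_eq0 (ip := ipH)); apply: Ou.
exact/eigenspace_S.
Qed.

Lemma Gamma1_inj : {in K &, injective Gamma1}.
Proof.
move=> u v; rewrite !inE => Ku Kv uv; apply/eqP; rewrite -subr_eq0; apply/eqP.
apply: Gamma1_ker; first exact: (subspaceB ominus_is_subspace).
case: Ku => -[[Du _] _] _; case: Kv => -[[Dv _] _] _.
by rewrite (linear_onB lG1) // uv subrr.
Qed.

(* The set of projections on [K] of the vectors [(T - lambda) w], [w] in [dom T]. *)
Let ranP : set H := [set k | K k /\ exists2 w, dom T w &
  forall v, K v -> ipH (T w - lambda%:C *: w) v = ipH k v].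

(** (T - lambda) w is split orthogonally into parts in the closure of ran (A0 - lambda), in ker (S -
    lambda) and in K. Only the last is seen by vectors of K, and [Gamma1] vanishes on the second. *)
Lemma decomposition w : dom T w ->
  exists2 k, ranP k /\ RM (Gamma0 w) = Gamma1 k &
    forall v, K v -> ipH (T w - lambda%:C *: w) v = ipH k v.
Proof.
move=> Dw.
have z0 : z 0 = lambda%:C by rewrite /z rmorph0 mulr0 addr0.
have sR := shift_range_is_subspace lambda 0 linear_A0.
rewrite -/(z 0) z0 in sR.
have [f clf] := closed_projectable hilbH (closure_is_subspace sR) (@closed_closure _ _)
  (T w - lambda%:C *: w).
move pE : (_ - f) => p op.
have Np : op_eigenspace A0 lambda%:C p.
  have : adjoint_graph ipH A0 (p, conjC (z 0) *: p).
    apply: ortho_shift_range; rewrite -/(z 0) z0 => v Rv; apply: op.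
    exact: subset_closure.
  by rewrite z0 conjC_realC -(proj2 saA0) => -[p' Dp' [<- e]]; split.
have ew : T w - lambda%:C *: w = f + p by rewrite -pE [RHS]addrC subrK.
have [s Ss] := closed_projectable hilbH (eigenspace_is_subspace lambda%:C linS)
  (eigenspace_closed clS) p.
move kE : (p - s) => k Ok.
have /eigenspace_S[Ns s1] := Ss.
have pks : p = k + s by apply/eqP; rewrite -subr_eq kE.
have Kk : K k.
  split=> //; rewrite -kE.
  by apply: subspaceB => //; exact: eigenspace_is_subspace linear_A0.
have ipk v : K v -> ipH (T w - lambda%:C *: w) v = ipH k v.
  move=> [[Dv ev] Ov]; rewrite ew pks !ipDl.
  rewrite (ip_sym0 (Ov s Ss)) addr0 (ip_sym0 (_ : ipH v f = 0)) ?add0r //.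
  apply: (closure_ortho hilbH _ clf) => _ [r Dr <-]; apply: ip_sym0.
  by rewrite ipDl ipNl ipZl (symA0 Dr Dv) ev ipZr conjC_realC subrr.
exists k => //; split; first by split=> //; exists w.
rewrite (weyl_residueE Dw clf Np ew) pks.
case: Kk => -[[Dk _] _] _; case: Ns => -[Ds _] _.
by rewrite (linear_onD lG1) // s1 addr0.
Qed.

Lemma ranP_is_subspace : is_subspace ranP.
Proof.
have [K0 KD] := ominus_is_subspace.
split.
  split=> //; exists 0; first by case: sT.
  by move=> v _; rewrite (linear_on0 sT lT) scaler0 subrr.
move=> a k k' [Kk [w Dw e]] [Kk' [w' Dw' e']]; split; first exact: KD.
exists (a *: w + w'); first exact: (proj2 sT).
move=> v Kv; rewrite (linear_on_shift lambda%:C lT) //.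
by rewrite !(ipDl, ipZl) -e // -e' // !(ipDl, ipNl, ipZl).
Qed.

(** An element of K is determined by its pairings with K, so the vector supplied by [decomposition]
    is the one named in [ranP]. *)
Lemma residue_range : op_range RM = Gamma1 @` ranP.
Proof.
apply/seteqP; split=> [_ [_ [w Dw <-] <-]|_ [k [Kk [w Dw e]] <-]].
  by have [k [Dk ->] _] := decomposition Dw; exists k.
have [k' [[Kk' _] r] e'] := decomposition Dw.
exists (Gamma0 w); first by exists w.
rewrite r; congr (Gamma1 _); apply/eqP; rewrite -subr_eq0; apply/eqP.
apply: (ip_eq0 (ip := ipH)).
have Kkk : K (k' - k) by exact: (subspaceB ominus_is_subspace).
by rewrite {1}ipDl ipNl -e // -e' // subrr.
Qed.

(** Orthogonality of [v] to [ranP] becomes, through Green's identity, orthogonality of [Gamma1 v] to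
    the dense range of [Gamma0]; [Gamma1] is injective on K. *)
Lemma ranP_total v : K v -> (forall k, ranP k -> ipH v k = 0) -> v = 0.
Proof.
move=> Kv h; apply: Gamma1_ker => //; apply: ortho_range_Gamma0 => w Dw.
have [k [Dk _] e] := decomposition Dw.
case: (Kv) => -[[Dv v0] ev] _; have := green Dw Dv; rewrite /= in v0 ev.
rewrite v0 ip0r sub0r ev ipZr conjC_realC -ipZl -ipNl -ipDl e // (ip_sym0 (h _ Dk)).
by move/eqP; rewrite eq_sym oppr_eq0 => /eqP /ip_sym0.
Qed.

Lemma ranP_dense : K `<=` closure ranP.
Proof.
have DK : closure ranP `<=` K.
  rewrite (closure_id K).1; last exact: ominus_closed.
  by apply: closureS => k [].
move=> v Kv.
have [d cd o] :=
  closed_projectable hilbH (closure_is_subspace ranP_is_subspace) (@closed_closure _ _) v.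
suff /eqP : v - d = 0 by rewrite subr_eq0 => /eqP ->.
apply: ranP_total; first by apply: (subspaceB ominus_is_subspace) => //; exact: DK.
by move=> k Dk; apply: o; exact: subset_closure.
Qed.

(** Here one can project onto [ranP] itself rather than its closure, and the remainder vanishes by
    [ranP_total]. *)
Lemma ranP_finite_dim : finite_dim K -> ranP = K.
Proof.
move=> fK; apply/seteqP; split=> [k []//|v Kv].
have DK : ranP `<=` K by move=> k [].
have [d Dd o] := finite_dim_projectable (ip := ipH) fK ranP_is_subspace DK v.
suff /eqP : v - d = 0 by rewrite subr_eq0 => /eqP ->.
by apply: ranP_total => //; apply: (subspaceB ominus_is_subspace) => //; exact: DK.
Qed.

(** On K the operator T - z (-1) is multiplication by i, so [Gamma1_bounded] makes [Gamma1]
    continuous there and carries the density of [ranP] over to its image. *)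
Lemma residue_range_dense : Gamma1 @` K `<=` closure (op_range RM).
Proof.
have [C C0 hC] := Gamma1_bounded.
move=> _ [v Kv <-]; apply/closure_nr => e e0.
have /closure_nr/(_ (e / (C + 1)))[|k Dk vk] := ranP_dense Kv; first by rewrite divr_gt0 //; lra.
exists (Gamma1 k); first by rewrite residue_range; exists k.
have [[Dvk ek] _] : K (v - k) by apply: (subspaceB ominus_is_subspace) => //; case: Dk.
have := hC _ Dvk; rewrite /= in ek; rewrite ek -scalerBl nrZ.
rewrite (_ : _ - z (-1) = 'i%R); last by rewrite /z rmorphN rmorph1; ring.
rewrite nr_i mul1r; case: Kv => -[[Dv _] _] _; case: Dk => -[[[Dk _] _] _] _.
rewrite (linear_onB lG1) // => /le_lt_trans; apply.
by move: vk; rewrite ltr_pdivlMr; [have := nr_ge0 (v - k); nra|lra].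
Qed.

(** The residue vanishes exactly when [ranP] is trivial, by injectivity of [Gamma1] on K, and [ranP]
    is trivial exactly when K is, by totality. *)
Lemma eigenvalue_iff :
  (op_eigenvalue A0 lambda%:C /\ K <> [set 0]) <-> op_nonzero RM.
Proof.
have K0 := proj1 ominus_is_subspace.
split=> [[_ KN0]|[g [w Dw <-] r0]].
  apply: contrapT => RM0; apply: KN0; apply/seteqP; split=> [v Kv|_ ->] //=.
  apply: ranP_total => // k Dk.
  suff -> : k = 0 by rewrite ip0r.
  apply: Gamma1_ker; first by case: Dk.
  have [g Dg <-] : op_range RM (Gamma1 k) by rewrite residue_range; exists k.
  by apply/eqP; apply: contrapT => /negP h; apply: RM0; exists g.
have [k [[Kk _] e] _] := decomposition Dw.
have k0 : k != 0.
  apply: contraNneq r0 => k0; rewrite e k0; apply/eqP.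
  exact: linear_on0 sT lG1.
split; first by exists k => //; case: Kk.
by move=> K1; move: Kk k0; rewrite K1 => /= ->; rewrite eqxx.
Qed.

(** Both targets turn out to be the full image of K under [Gamma1], so only injectivity remains. *)
Lemma residue_bijections :
  (finite_dim K -> set_bij K (op_range RM) Gamma1) /\
  (op_range RM `<=` Gamma1 @` K /\
   set_bij K (relative_closure (Gamma1 @` K) (op_range RM)) Gamma1).
Proof.
have sub : op_range RM `<=` Gamma1 @` K.
  by rewrite residue_range; apply: image_subset => k [].
split=> [fK|].
  rewrite residue_range (ranP_finite_dim fK); split=> //.
  exact: Gamma1_inj.
split=> //; rewrite /relative_closure setIidl; last exact: residue_range_dense.
by split=> //; exact: Gamma1_inj.
Qed.

End Point.
End BoundaryTriple.

Unset Implicit Arguments.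
Set Strict Implicit.

Theorem theorem3p2 (R : realType) (H G : completeNormedModType R[i])
    (ipH : {dot H for conjC}) (ipG : {dot G for conjC})
    (hilbertH : norm_induced_by ipH) (hilbertG : norm_induced_by ipG)
    (separableH : separable H)
    (S T : operator H H) (Gamma0 Gamma1 : H -> G)
    (linearS : linear_operator S) (closedS : closed_operator S)
    (denseS : densely_defined S) (symmetricS : symmetric_operator ipH S)
    (qbt : quasi_boundary_triple ipH ipG S T Gamma0 Gamma1)
    (lambda : R) :
  let A0 := A0_of T Gamma0 in
  let K := ominus ipH (op_eigenspace A0 lambda%:C)
                      (op_eigenspace S lambda%:C) in
  let RM := weyl_residue T Gamma0 Gamma1 lambda in
  [/\ (op_eigenvalue A0 lambda%:C /\ K <> [set 0]) <-> op_nonzero RM,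
      finite_dim K -> set_bij K (op_range RM) Gamma1
    & ~ finite_dim K ->
        op_range RM `<=` Gamma1 @` K /\
        set_bij K (relative_closure (Gamma1 @` K) (op_range RM)) Gamma1].
Proof.
move=> A0 K RM.
have [fin inf] := residue_bijections hilbertH hilbertG linearS closedS symmetricS qbt lambda.
split=> //.
by have := eigenvalue_iff hilbertH hilbertG linearS closedS symmetricS qbt lambda.
Qed.
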